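(* Let $\bar j\in\{1,2,\dots\}$, and let $\hat{\mathbb{Z}}^{\bar j}_{\mathrm{svm}}$ be the constraint estimate defined in the context: for $\bar j=1$ it is $\hat{\mathbb{Z}}^1=\{(x,u): H_x^{\mathrm b}x\le h_x^{\mathrm b},\ H_uu\le h_u\}$, and for $\bar j>1$ it is the SVM-based estimate formed from the closed-loop trajectories of iterations $1,\dots,\bar j-1$. Let this fixed set be used as the constraint estimate ($\hat{\mathbb{Z}}^j=\hat{\mathbb{Z}}^{\bar j}_{\mathrm{svm}}$) in the MPC controller for the next $N_{\mathrm{it}}$ iterations, beginning with iteration $\bar j$, i.e. for iterations $\bar j,\bar j+1,\dots,\bar j+N_{\mathrm{it}}-1$. Let $\epsilon\in(0,1)$ and $0<\beta\ll 1$ (a small number in $(0,1)$). If all of these $N_{\mathrm{it}}$ iterations are Successful Iterations and $$N_{\mathrm{it}}\ \ge\ \frac{\ln(1/\beta)}{\ln\big(1/(1-\epsilon)\big)},$$ then, with confidence at least $1-\beta$, $\mathbb{P}([\mathrm{IF}]^j)\le\epsilon$ for all task iterations $j\ge\bar j$ that use $\hat{\mathbb{Z}}^j=\hat{\mathbb{Z}}^{\bar j}_{\mathrm{svm}}$. Here $\mathbb{P}([\mathrm{IF}]^j)$ is the probability, over the disturbance sequence of a single iteration with the set $\hat{\mathbb{Z}}^{\bar j}_{\mathrm{svm}}$ held fixed, that the iteration fails; it is the same number for all such $j$. ''With confidence at least $1-\beta$'' means: with respect to the joint law of the $N_{\mathrm{it}}$ independent disturbance sequences of iterations $\bar j,\dots,\bar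 j+N_{\mathrm{it}}-1$ (with the set $\hat{\mathbb{Z}}^{\bar j}_{\mathrm{svm}}$ fixed), the event ''if all $N_{\mathrm{it}}$ iterations are successful, then $\mathbb{P}([\mathrm{IF}]^j)\le\epsilon$'' has probability at least $1-\beta$.
   Context: **System and constraints.** $x_{t+1}=Ax_t+Bu_t+w_t$ with $x_t\in\mathbb{R}^n$, $u_t\in\mathbb{R}^m$, $A,B$ known matrices, and $w_t$ i.i.d. random disturbances (over time steps and over iterations) with polytopic support $\mathbb{W}\subset\mathbb{R}^n$. The true constraint set is $\mathbb{Z}=\{(x,u):H_xx\le h_x,\ H_uu\le h_u\}$, where $H_x=\begin{bmatrix}H_x^{\mathrm b}\\ H_x^{\mathrm{ub}}\end{bmatrix}$, $h_x=\begin{bmatrix}h_x^{\mathrm b}\\ h_x^{\mathrm{ub}}\end{bmatrix}$; the parts with superscript $\mathrm b$ are known to the designer and those with superscript $\mathrm{ub}$ are unknown. It is assumed that $x=0$ satisfies $H_xx\le h_x$. Inequalities are componentwise. **Iterations.** The system performs the same task repeatedly. Iteration $j\in\{1,2,\dots\}$ starts at the fixed state $x_0^j=x_S$ and runs for $T$ time steps, with states $x_0^j,\dots,x_T^j$ and disturbances $w_0^j,\dots,w_{T-1}^j$. Iteration $j$ uses a constraint estimate $\hat{\mathbb{Z}}^j=\{(x,u):\hat{H}_x^jx\le\hat{h}_x^j,\ H_uu\le h_u\}$. **MPC controller.** Let $1\le N\le T$ be the prediction horizon, $\ell$ and $Q$ positive definite stage and terminal costs, and $K$ a gain with $A+BK$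 stable. At time $t$ of iteration $j$, with measured state $x_t^j$, solve $$\min\ \sum_{k=t}^{t+N-1}\ell(\bar x_{k|t},v_{k|t})+Q(\bar x_{t+N|t})$$ over vectors $v_{k|t}\in\mathbb{R}^m$ and matrices $M_{k,l|t}\in\mathbb{R}^{m\times n}$ ($t\le l<k\le t+N-1$), subject to $\bar x_{k+1|t}=A\bar x_{k|t}+Bv_{k|t}$; $x_{k+1|t}=Ax_{k|t}+Bu_{k|t}+w_{k|t}$; $u_{k|t}=\sum_{l=t}^{k-1}M_{k,l|t}w_{l|t}+v_{k|t}$; $\hat{H}_x^jx_{k|t}\le\hat{h}_x^j$; $H_uu_{k|t}\le h_u$; $x_{t|t}=\bar x_{t|t}=x_t^j$; $x_{t+N|t}\in\hat{\mathcal X}_N^j$; all constraints holding for all $w_{k|t}\in\mathbb{W}$ and all $k=t,\dots,t+N-1$. The terminal set $\hat{\mathcal X}_N^j$ is the polyhedral $(T-N)$-step robust reachable set under $u=Kx$: every $x\in\hat{\mathcal X}_N^j$ satisfies $(x,Kx)\in\hat{\mathbb{Z}}^j$, and for all $i=1,\dots,T-N$ and all $w_0,\dots,w_{i-1}\in\mathbb{W}$, the point $y=(A+BK)^ix+\sum_{\tilde i=0}^{i-1}(A+BK)^{i-\tilde i-1}w_{\tilde i}$ satisfies $\hat{H}_x^jy\le\hat{h}_x^j$ and $H_uKy\le h_u$. The applied input is $u_t^j=v_{t|t}^{j,\star}$ (from a minimizer), and the procedure is repeated at time $t+1$. When an estimate is used, the controller is assumed well defined (the problems solved are feasible), so that for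 a fixed estimate the closed-loop trajectory is a fixed measurable function, the same for every iteration using that estimate, of the iteration's disturbance sequence $(w_0^j,\dots,w_{T-1}^j)$. **Successful iteration and failure.** $[\mathrm{SI}]^j$ is the event that $H_xx_t^j\le h_x$ for all $t=0,1,\dots,T$. The Iteration Failure $[\mathrm{IF}]^j$ is its complement. **SVM-based estimate.** $\hat{\mathbb{Z}}^1_{\mathrm{svm}}=\hat{\mathbb{Z}}^1=\{(x,u):H_x^{\mathrm b}x\le h_x^{\mathrm b},\ H_uu\le h_u\}$. For $j\ge1$, let $f^j:\mathbb{R}^n\to\mathbb{R}$ be a classifier (obtained by a kernelized Support Vector Machine) that separates all states visited in iterations $1,\dots,j$ according to whether they satisfy $H_xx\le h_x$, with $f^j(0)\le0$. Let $\{x:\hat{H}^{j+1}_{x,\mathrm{svm}}x\le\hat{h}^{j+1}_{x,\mathrm{svm}}\}$ be a polyhedral inner approximation of $\{x:f^j(x)\le0\}\cap\{x:H_x^{\mathrm b}x\le h_x^{\mathrm b}\}$, and set $\hat{\mathbb{Z}}^{j+1}_{\mathrm{svm}}=\{(x,u):\hat{H}^{j+1}_{x,\mathrm{svm}}x\le\hat{h}^{j+1}_{x,\mathrm{svm}},\ H_uu\le h_u\}$. This set is not necessarily contained in $\mathbb{Z}$. *)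

(* Defs.v *)
From mathcomp Require Import all_boot all_order all_algebra.
From mathcomp Require Import complex.
From mathcomp Require Import all_classical all_reals all_analysis.

Set Implicit Arguments.
Unset Strict Implicit.
Unset Printing Implicit Defensive.

Import Order.TTheory GRing.Theory Num.Theory.
Import numFieldNormedType.Exports.

Local Open Scope classical_set_scope.
Local Open Scope ring_scope.

Definition lecv (R : realType) (p : nat) (x y : 'cV[R]_p) : bool :=
  [forall i, x i 0 <= y i 0].

(* 'cV[R]_n carrying its Borel sigma-algebra *)
Definition borelcV (R : realType) (n : nat) :=
  g_sigma_algebraType (@open 'cV[R]_n).

Definition polyhedron (R : realType) (n p : nat) (H : 'M[R]_(p, n))
    (h : 'cV[R]_p) : set 'cV[R]_n :=
  [set x | lecv (H *m x) h].

Definition polyhedral (R : realType) (n : nat) (X : set 'cV[R]_n) : Prop :=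
  exists p (H : 'M[R]_(p, n)) (h : 'cV[R]_p), X = polyhedron H h.

Definition polytope (R : realType) (n : nat) (X : set 'cV[R]_n) : Prop :=
  polyhedral X /\ exists M : R, forall x, X x -> forall i, `|x i 0| <= M.

(* A square matrix is (Schur) stable when its complex eigenvalues lie in the
   open unit disc. *)
Definition stable (R : realType) (n : nat) (F : 'M[R]_n) : Prop :=
  forall a : R[i], eigenvalue (map_mx (real_complex R) F) a -> `|a| < 1.

Definition posdef (R : realType) (V : nmodType) (f : V -> R) : Prop :=
  f 0 = 0 /\ forall z, z != 0 -> 0 < f z.

Section Probability.
Context (R : realType) (d d' : measure_display).
Context (Om : measurableType d) (E : measurableType d') (P : probability Om R).

Definition mutually_independent (I : choiceType) (D : set I)
    (X : I -> Om -> E) : Prop :=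
  forall s : seq I, uniq s -> (forall i, i \in s -> D i) ->
  forall B : I -> set E, (forall i, measurable (B i)) ->
  P (\bigcap_(i in [set` s]) (X i @^-1` B i)) =
  (\prod_(i <- s) P (X i @^-1` B i))%E.

Definition identically_distributed (I : Type) (D : set I)
    (X : I -> Om -> E) : Prop :=
  forall i i', D i -> D i' -> forall B : set E, measurable B ->
  P (X i @^-1` B) = P (X i' @^-1` B).

Definition iid (I : choiceType) (D : set I) (X : I -> Om -> E) : Prop :=
  [/\ forall i, D i -> measurable_fun setT (X i),
      mutually_independent D X & identically_distributed D X].

End Probability.

(* W is the support of the law of X: the least closed set of probability 1. *)
Definition is_support (R : realType) (d : measure_display)
    (Om : measurableType d) (P : probability Om R) (n : nat)
    (X : Om -> 'cV[R]_n) (W : set 'cV[R]_n) : Prop :=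
  [/\ closed W, P (X @^-1` W) = 1%E &
      forall C : set 'cV[R]_n, closed C -> P (X @^-1` C) = 1%E -> W `<=` C].

Record task (R : realType) (n m : nat) := Task {
  sysA : 'M[R]_n;
  sysB : 'M[R]_(n, m);
  distW : set 'cV[R]_n;
  known_rows : nat;
  Hb : 'M[R]_(known_rows, n);
  hb : 'cV[R]_known_rows;
  unknown_rows : nat;
  Hub : 'M[R]_(unknown_rows, n);
  hub : 'cV[R]_unknown_rows;
  input_rows : nat;
  Hu : 'M[R]_(input_rows, m);
  hu : 'cV[R]_input_rows;
  xS : 'cV[R]_n;
  duration : nat;
  horizon : nat;
  stage_cost : 'cV[R]_n * 'cV[R]_m -> R;
  terminal_cost : 'cV[R]_n -> R;
  gainK : 'M[R]_(m, n)
}.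

Section Task.
Context (R : realType) (n m : nat) (S : task R n m).

Local Notation state := 'cV[R]_n.
Local Notation input := 'cV[R]_m.
Local Notation A := (sysA S).
Local Notation B := (sysB S).
Local Notation W := (distW S).
Local Notation K := (gainK S).
Local Notation T := (duration S).
Local Notation N := (horizon S).

Definition Hx : 'M[R]_(known_rows S + unknown_rows S, n) := col_mx (Hb S) (Hub S).
Definition hx : 'cV[R]_(known_rows S + unknown_rows S) := col_mx (hb S) (hub S).

Definition task_ok : Prop :=
  [/\ polytope W, lecv (Hx *m 0) hx, (1 <= N <= T)%N,
      posdef (stage_cost S) /\ posdef (terminal_cost S) &
      stable (A + B *m K)].

Definition constraint_set (p : nat) (H : 'M[R]_(p, n)) (h : 'cV[R]_p) :
    set (state * input) :=
  [set z | lecv (H *m z.1) h /\ lecv (Hu S *m z.2) (hu S)].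

Definition constraint_estimate (Z : set (state * input)) : Prop :=
  exists p (H : 'M[R]_(p, n)) (h : 'cV[R]_p), Z = constraint_set H h.

Definition known_estimate : set (state * input) := constraint_set (Hb S) (hb S).

(* The MPC problem is invariant under time shifts, so prediction steps are
   counted from the current time: index k stands for t + k.  Among the decision
   variables v k and M k l only those with l < k < N are relevant. *)
Fixpoint nominal (x : state) (v : nat -> input) (k : nat) : state :=
  if k is k'.+1 then A *m nominal x v k' + B *m v k' else x.

Definition policy (v : nat -> input) (M : nat -> nat -> 'M[R]_(m, n))
    (w : nat -> state) (k : nat) : input :=
  \sum_(0 <= l < k) M k l *m w l + v k.

Fixpoint predicted (x : state) (v : nat -> input)
    (M : nat -> nat -> 'M[R]_(m, n)) (w : nat -> state) (k : nat) : state :=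
  if k is k'.+1
  then A *m predicted x v M w k' + B *m policy v M w k' + w k'
  else x.

Definition mpc_cost (x : state) (v : nat -> input) : R :=
  \sum_(0 <= k < N) stage_cost S (nominal x v k, v k)
    + terminal_cost S (nominal x v N).

Definition mpc_feasible (Z : set (state * input)) (XN : set state) (x : state)
    (v : nat -> input) (M : nat -> nat -> 'M[R]_(m, n)) : Prop :=
  forall w : nat -> state, (forall k, (k < N)%N -> W (w k)) ->
    (forall k, (k < N)%N -> Z (predicted x v M w k, policy v M w k)) /\
    XN (predicted x v M w N).

Definition mpc_minimizer (Z : set (state * input)) (XN : set state) (x : state)
    (v : nat -> input) (M : nat -> nat -> 'M[R]_(m, n)) : Prop :=
  mpc_feasible Z XN x v M /\
  forall v' M', mpc_feasible Z XN x v' M' -> mpc_cost x v <= mpc_cost x v'.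

Definition mpc_input (Z : set (state * input)) (XN : set state) (x : state)
    (u : input) : Prop :=
  exists v M, mpc_minimizer Z XN x v M /\ u = v 0%N.

Definition reached (i : nat) (x : state) (w : nat -> state) : state :=
  (A + B *m K) ^+ i *m x
    + \sum_(0 <= s < i) (A + B *m K) ^+ (i - s - 1) *m w s.

Definition terminal_set (Z : set (state * input)) (XN : set state) : Prop :=
  polyhedral XN /\
  forall x, XN x -> Z (x, K *m x) /\
    forall i, (1 <= i <= T - N)%N ->
    forall w : nat -> state, (forall s, (s < i)%N -> W (w s)) ->
    Z (reached i x w, K *m reached i x w).

Section ClosedLoop.
(* The applied input is selected from the states measured so far, listed with
   the current state first; selecting by x_t alone is a special case. *)
Variable kappa : seq state -> input.

Fixpoint history (ws : seq state) (t : nat) : seq state :=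
  if t is t'.+1 then
    let h := history ws t' in
    (A *m head 0 h + B *m kappa h + nth 0 ws t') :: h
  else [:: xS S].

Definition closed_loop (ws : seq state) (t : nat) : state :=
  head 0 (history ws t).

Definition successful (ws : seq state) : Prop :=
  forall t, (t <= T)%N -> lecv (Hx *m closed_loop ws t) hx.

(* Only disturbance sequences with values in W need feasible MPC problems; on
   other sequences kappa is a dummy totalization. *)
Definition mpc_controller (Z : set (state * input)) (XN : set state) : Prop :=
  (forall t, (t <= T)%N ->
     measurable_fun setT
       (fun ws : T.-tuple (borelcV R n) => closed_loop ws t : borelcV R n)) /\
  forall ws : T.-tuple state, (forall i, W (tnth ws i)) ->
  forall t, (t < T)%N -> mpc_input Z XN (closed_loop ws t) (kappa (history ws t)).

End ClosedLoop.

Definition psd_kernel (k : state -> state -> R) : Prop :=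
  (forall x y, k x y = k y x) /\
  forall p (c : 'I_p -> R) (x : 'I_p -> state),
    0 <= \sum_i \sum_j c i * c j * k (x i) (x j).

(* Decision functions of kernel support vector machines trained on the states in
   V and the origin (a point known to be feasible): expansions over training
   points with nonnegative dual variables a and labels -1 (feasible), +1. *)
Definition kernel_svm (V : set state) (f : state -> R) : Prop :=
  exists k, psd_kernel k /\
  exists p (a : 'I_p -> R) (s : 'I_p -> state) (b : R),
    [/\ forall i, 0 <= a i, forall i, V (s i) \/ s i = 0 &
        forall x, f x =
          \sum_i a i * (if lecv (Hx *m s i) hx then -1 else 1) * k (s i) x + b].

Definition svm_classifier (V : set state) (f : state -> R) : Prop :=
  [/\ kernel_svm V f, forall x, V x -> f x <= 0 <-> lecv (Hx *m x) hx & f 0 <= 0].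

(* V j stands for the set of states visited in iterations 1, ..., j. *)
Definition svm_estimate (V : nat -> set state) (jbar : nat)
    (Z : set (state * input)) : Prop :=
  if (jbar <= 1)%N then Z = known_estimate else
  exists f p (H : 'M[R]_(p, n)) (h : 'cV[R]_p),
    [/\ svm_classifier (V jbar.-1) f,
        polyhedron H h `<=` [set x | f x <= 0] `&` polyhedron (Hb S) (hb S) &
        Z = constraint_set H h].

Section Process.
Context (d : measure_display) (Om : measurableType d) (P : probability Om R).
(* w (j, t) is the disturbance at time t of iteration j >= 1. *)
Variable w : nat * nat -> Om -> borelcV R n.

Definition disturbance_index : set (nat * nat) :=
  [set jt | (1 <= jt.1)%N /\ (jt.2 < T)%N].

Definition disturbances : Prop :=
  iid P disturbance_index w /\
  forall jt, disturbance_index jt -> is_support P (w jt) W.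

Definition dist_seq (j : nat) (om : Om) : T.-tuple state :=
  [tuple w (j, val t) om | t < T].

(* The controller depends on the iteration only through the estimate in use. *)
Variable kappa : set (state * input) -> seq state -> input.
Variable Zhat : nat -> set (state * input).

(* om is the outcome of the past iterations that produced the estimate. *)
Definition visited (om : Om) (j : nat) : set state :=
  [set x | exists i t, [/\ (1 <= i <= j)%N, (t <= T)%N &
     x = closed_loop (kappa (Zhat i)) (dist_seq i om) t]].

Definition successful_iteration (j : nat) : set Om :=
  [set om | successful (kappa (Zhat j)) (dist_seq j om)].

Definition iteration_failure (j : nat) : set Om := ~` successful_iteration j.

End Process.
End Task.

(* Main.v *)
(* Let q be the success probability of one iteration run with the estimate Zsvm.
   Disjoint blocks of an i.i.d. family are themselves i.i.d. (the product rule
   extends from measurable boxes to all measurable sets of disturbance sequences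
   by a pi-lambda argument), so all Nit iterations succeed with probability
   q ^ Nit.  If 1 - q <= epsilon, the event is sure.  Otherwise it is the event
   that some iteration fails, whose complement has probability
   q ^ Nit <= (1 - epsilon) ^ Nit <= beta. *)

Require Import Defs.
From mathcomp Require Import all_boot all_order all_algebra.
From mathcomp Require Import all_classical all_reals all_analysis.

Import Order.TTheory GRing.Theory Num.Theory.
Import numFieldNormedType.Exports.

Local Open Scope classical_set_scope.
Local Open Scope ring_scope.

(** * Independence tested on a generating pi-system *)

(** As functions of [A], both sides are finite measures on [E]: the law of [X] restricted to [D],
    and the law of [X] scaled by [P D]. They agree on the pi-system [G], hence on the sigma-algebra
    it generates. *)
Lemma independent_generated (R : realType) (d d' : measure_display)
    (Om : measurableType d) (E : measurableType d') (P : probability Om R)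
    (X : Om -> E) (D : set Om) (G : set (set E)) :
  measurable_fun setT X -> measurable D ->
  @measurable _ E = <<s G >> -> setI_closed G -> G setT ->
  (forall A, G A -> P (X @^-1` A `&` D) = (P (X @^-1` A) * P D)%E) ->
  forall A, measurable A -> P (X @^-1` A `&` D) = (P (X @^-1` A) * P D)%E.
Proof.
move=> mX mD mG GI GT PG A mA.
have pD0 : (0 <= fine (P D))%R by exact: fine_ge0.
have PDE : (fine (P D))%:E = P D by rewrite fineK// fin_num_measure.
pose m1 : {measure set E -> \bar R} := pushforward (mrestr P mD) X.
pose m2 : {measure set E -> \bar R} :=
  mscale (NngNum pD0) (pushforward P X).
suff : m1 mX A = m2 mX A.
  by rewrite /m1 /m2 /= /mscale /= /pushforward /mrestr /= PDE muleC.
(* The exhaustion of [E] by sets of [G] of finite mass is the constant sequence [setT]. *)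
apply: (measure_unique G (fun=> setT)) => //.
- by rewrite bigcup_const.
- move=> B GB.
  by rewrite /m1 /m2 /= /mscale /= /pushforward /mrestr /= PDE muleC PG.
- move=> _; change (P (X @^-1` setT `&` D) < +oo)%E; rewrite preimage_setT setTI.
  by rewrite -ge0_fin_numE// fin_num_measure.
Qed.

Lemma mutually_independent_generated (R : realType) (d d' : measure_display)
    (Om : measurableType d) (E : measurableType d') (P : probability Om R)
    (I : choiceType) (D : set I) (X : I -> Om -> E) (G : set (set E)) :
  (forall i, D i -> measurable_fun setT (X i)) ->
  @measurable _ E = <<s G >> -> setI_closed G -> G setT ->
  (forall s : seq I, uniq s -> (forall i, i \in s -> D i) ->
   forall B : I -> set E, (forall i, G (B i)) ->
   P (\bigcap_(i in [set` s]) (X i @^-1` B i)) =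
   (\prod_(i <- s) P (X i @^-1` B i))%E) ->
  mutually_independent P D X.
Proof.
move=> mX mG GI GT PG s us sD.
pose rule B := P (\bigcap_(i in [set` s]) (X i @^-1` B i)) =
  (\prod_(i <- s) P (X i @^-1` B i))%E.
have eq_rule (B B' : I -> set E) : {in s, B =1 B'} -> rule B -> rule B'.
  move=> BB' rB; rewrite /rule -(eq_bigcapr (F := fun i => X i @^-1` B i)).
    by rewrite rB; apply: eq_big_seq => i si; rewrite BB'.
  by move=> i /= si; rewrite BB'.
(* Induction on r: one more coordinate at a time goes from G to the whole
   sigma-algebra, by uniqueness of measures on a pi-system. *)
have rule_outside (r : seq I) (B : I -> set E) : (forall i, measurable (B i)) ->
    (forall i, i \notin r -> G (B i)) -> rule B.
  elim: r B => [|i0 r IH] B mB GB; first by apply: PG => // i; exact: GB.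
  pose B' A i := if i == i0 then A else B i.
  have rB' A : G A -> rule (B' A).
    move=> GA; apply: IH => i; rewrite /B'; case: eqP => // /eqP ii0.
      by rewrite mG; exact: sub_sigma_algebra.
    by move=> ir; apply: GB; rewrite inE negb_or ii0.
  (* If [i0] is not in [s], the set at [i0] does not enter the rule and may be replaced by [setT],
     which lies in [G]. *)
  have [si0|si0] := boolP (i0 \in s); last first.
    apply: (eq_rule (B' setT)); last exact: rB'.
    by move=> i si; rewrite /B'; case: eqP si si0 => [->->|].
  (* The event fixed by the other coordinates; it plays the role of [D] in [independent_generated],
     with [X i0] as the variable. *)
  pose rest := \bigcap_(i in [set` [seq j <- s | j != i0]]) (X i @^-1` B i).
  have capE A : \bigcap_(i in [set` s]) (X i @^-1` B' A i) = X i0 @^-1` A `&` rest.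
    apply/seteqP; split=> om /=.
      move=> h; split; first by have := h i0 si0; rewrite /B' /= eqxx.
      move=> i /=; rewrite mem_filter => /andP[/negbTE ii0 si].
      by have := h i si; rewrite /B' /= ii0.
    move=> [hA h] i /= si; rewrite /B'; case: eqP => [->//|/eqP ii0].
    by apply: h; rewrite /= mem_filter ii0.
  have prodE A : (\prod_(i <- s) P (X i @^-1` B' A i) =
      P (X i0 @^-1` A) * \prod_(i <- s | i != i0) P (X i @^-1` B i))%E.
    rewrite (bigD1_seq i0)//= {1}/B' eqxx; congr (_ * _)%E.
    by apply: eq_bigr => i /negbTE ii0; rewrite /B' ii0.
  (* Taking [setT] at [i0] removes that coordinate and leaves the product rule for [rest]. *)
  have restE : P rest = (\prod_(i <- s | i != i0) P (X i @^-1` B i))%E.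
    have := rB' _ GT.
    by rewrite /rule capE prodE preimage_setT setTI probability_setT mul1e.
  apply: (eq_rule (B' (B i0))); first by move=> i _; rewrite /B'; case: eqP => [->|].
  rewrite /rule capE prodE -restE; apply: (@independent_generated _ _ _ _ _ _ _ _ G) => //.
  - exact/mX/sD.
  - apply: fin_bigcap_measurable; first exact: finite_seq.
    move=> i /=; rewrite mem_filter => /andP[_ si].
    by rewrite -[_ @^-1` _]setTI; apply: mX => //; exact: sD.
  - by move=> A GA; have := rB' _ GA; rewrite /rule capE prodE -restE.
move=> B mB.
(* Off [s] the sets are free, so [setT] is put there to meet the demand of [rule_outside] that they
   lie in [G]. *)
apply: (eq_rule (fun i => if i \in s then B i else setT)).
  by move=> i ->.
by apply: (rule_outside s) => i; case: ifP.
Qed.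

(** * Blocks of an i.i.d. family *)

Definition boxes {d : measure_display} (E : measurableType d) (n : nat) :
    set (set (n.-tuple E)) :=
  [set A | exists2 C : 'I_n -> set E, forall i, measurable (C i) &
     A = [set x | forall i, C i (tnth x i)]].

(** The tuple sigma-algebra is generated by one-coordinate cylinders. A cylinder is a box with all
    other sides [setT], and a box is a finite intersection of cylinders. *)
Lemma measurable_tuple_boxes (d : measure_display) (E : measurableType d)
    (n : nat) :
  @measurable _ (n.-tuple E) = <<s boxes E n >>.
Proof.
apply/seteqP; split.
- apply: smallest_sub; first exact: smallest_sigma_algebra.
  move=> A; rewrite -bigcup_seq => -[i _ [C mC <-]].
  apply: sub_sigma_algebra; rewrite setTI.
  exists (fun j => if j == i then C else setT) => [j|]; first by case: eqP.
  apply/seteqP; split => [x Cx j|x /(_ i)]; last by rewrite eqxx.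
  by case: eqP => [->|].
- apply: smallest_sub; first exact: sigma_algebra_measurable.
  move=> A [C mC ->].
  rewrite (_ : [set x | _] =
      \bigcap_(i in [set: 'I_n]) ((@tnth n E)^~ i @^-1` C i)).
    apply: fin_bigcap_measurable => // i _.
    by rewrite -[_ @^-1` _]setTI; exact: measurable_tnth.
  by apply/seteqP; split=> x /= h i; [move=> _|]; exact: h.
Qed.

(** On boxes, block events are intersections of events on single variables, so joint and marginal
    probabilities factor over the same indices (j, t). Boxes form a generating pi-system, so
    independence and equality of laws extend from them to all measurable sets of tuples. *)
Lemma iid_tuple (R : realType) (d d' : measure_display)
    (Om : measurableType d) (E : measurableType d') (P : probability Om R)
    (J : choiceType) (D : set J) (n : nat) (X : J * nat -> Om -> E) :
  iid P [set jt | D jt.1 /\ (jt.2 < n)%N] X ->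
  iid P D (fun j om => [tuple X (j, val t) om | t < n] : n.-tuple E).
Proof.
move=> [mX indX idX].
have mY j : D j ->
    measurable_fun setT (fun om => [tuple X (j, val t) om | t < n] : n.-tuple E).
  move=> Dj; apply/measurable_fun_tnthP => i.
  have -> : (@tnth n E)^~ i \o (fun om => [tuple X (j, val t) om | t < n]) =
      X (j, val i).
    by apply/funext => om /=; rewrite tnth_mktuple.
  by apply: mX; split => //=; exact: ltn_ord.
have boxE C j : [set om | forall i : 'I_n, C i (X (j, val i) om)] =
    (fun om => [tuple X (j, val t) om | t < n]) @^-1` [set x | forall i, C i (tnth x i)].
  by apply/seteqP; split=> om /= h i; have := h i; rewrite tnth_mktuple.
have box_prob (s : seq J) (C : J -> 'I_n -> set E) : uniq s ->
    (forall j, j \in s -> D j) -> (forall j i, measurable (C j i)) ->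
    P (\bigcap_(j in [set` s]) [set om | forall i, C j i (X (j, val i) om)]) =
    (\prod_(j <- s) \prod_(i < n) P (X (j, val i) @^-1` C j i))%E.
  move=> us sD mC.
  (* The doubly indexed sides become one family on pairs, as [indX] requires. The default [setT]
     keeps every [B jt] measurable; no pair in the list below reaches it. *)
  pose B (jt : J * nat) := if insub jt.2 is Some i then C jt.1 i else setT.
  have BE j (i : 'I_n) : B (j, val i) = C j i by rewrite /B /= valK.
  have := indX [seq (j, val i) | j <- s, i <- index_enum 'I_n] _ _ B _.
  rewrite big_allpairs_dep /= => h; transitivity
    (\prod_(j <- s) \prod_(i < n) P (X (j, val i) @^-1` B (j, val i)))%E; last first.
    by apply: eq_bigr => j _; apply: eq_bigr => i _; rewrite BE.
  rewrite -h.
  - congr (P _); apply/seteqP; split=> om /= hom.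
      by move=> _ /allpairsP[[j i] /= [js _ ->]]; rewrite /= BE; exact: hom.
    move=> j js i; have := hom (j, val i); rewrite /= BE; apply.
    by apply/allpairsP; exists (j, i); split => //; rewrite mem_index_enum.
  - apply: allpairs_uniq => //; first exact: index_enum_uniq.
    by move=> [j i] [j' i'] _ _ /= [-> /val_inj ->].
  - by move=> _ /allpairsP[[j i] /= [js _ ->]]; split; [exact: sD|exact: ltn_ord].
  - by move=> jt; rewrite /B; case: insubP.
have box_prob1 j (C : 'I_n -> set E) : D j -> (forall i, measurable (C i)) ->
    P [set om | forall i, C i (X (j, val i) om)] =
    (\prod_(i < n) P (X (j, val i) @^-1` C i))%E.
  move=> Dj mC; have := box_prob [:: j] (fun=> C).
  rewrite big_seq1 => <- //; last by move=> k; rewrite inE => /eqP ->.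
  congr (P _); apply/seteqP; split=> om /= h; last by apply: (h j); rewrite /= inE.
  by move=> k /=; rewrite inE => /eqP ->.
have boxesI : setI_closed (boxes E n).
  move=> _ _ [C mC ->] [C' mC' ->]; exists (fun i => C i `&` C' i).
    by move=> i; exact: measurableI.
  apply/seteqP; split=> x /=; first by move=> [h h'] i; split.
  by move=> h; split=> i; case: (h i).
have boxesT : boxes E n setT.
  by exists (fun=> setT) => //; apply/seteqP; split.
split=> //.
- apply: (mutually_independent_generated _ _ _ _ _ _ _ _ _ (boxes E n)) => //.
    exact: measurable_tuple_boxes.
  (* Choice provides the sides [C j] of all the boxes [B j] at once. *)
  move=> s us sD B /(_ _)/cid2-/all_sig2[C mC BC].
  transitivity (P (\bigcap_(j in [set` s])
      [set om | forall i, C j i (X (j, val i) om)])).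
    by congr (P _); apply: eq_bigcapr => j _; rewrite BC boxE.
  rewrite box_prob//; apply: eq_big_seq => j js.
  by rewrite BC -boxE box_prob1//; exact: sD.
- move=> j j' Dj Dj' B mB.
  pose m1 : {measure set (n.-tuple E) -> \bar R} :=
    pushforward P (fun om => [tuple X (j, val t) om | t < n]).
  pose m2 : {measure set (n.-tuple E) -> \bar R} :=
    pushforward P (fun om => [tuple X (j', val t) om | t < n]).
  suff : m1 (mY j Dj) B = m2 (mY j' Dj') B by [].
  apply: (measure_unique (boxes E n) (fun=> setT)) => //.
  + exact: measurable_tuple_boxes.
  + by rewrite bigcup_const.
  + move=> _ [C mC ->]; rewrite /m1 /m2 /= /pushforward -!boxE !box_prob1//.
    by apply: eq_bigr => i _; apply: idX => //; split => //=; exact: ltn_ord.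
  + move=> _; rewrite -[m1 _ _]/(P (_ @^-1` setT)) preimage_setT.
    by rewrite probability_setT ltry.
Qed.

(** * Measurability of the success event *)

Lemma measurable_polyhedron (R : realType) (n p : nat) (H : 'M[R]_(p, n))
    (h : 'cV[R]_p) : measurable (polyhedron H h : set (borelcV R n)).
Proof.
pose row_le i := [set x : borelcV R n | (H *m x) i 0 <= h i 0].
have -> : polyhedron H h = \bigcap_(i in [set: 'I_p]) row_le i.
  apply/seteqP; split=> x /=; first by move=> /forallP hx i _; exact: hx.
  by move=> hx; apply/forallP => i; exact: hx.
apply: fin_bigcap_measurable => // i _.
have cts : continuous (fun x : 'cV[R]_n => \sum_j H i j * x j 0).
  apply: continuous_big; first exact: add_continuous.
  move=> j _ x.
  apply: (continuous_comp (f := fun y : 'cV[R]_n => y j 0)).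
    exact: coord_continuous.
  exact: mulrl_continuous.
have cl : closed ((fun x : 'cV[R]_n => \sum_j H i j * x j 0) @^-1`
    [set y | y <= h i 0]).
  exact: ((continuous_closedP _).1 cts _ (@closed_le R _)).
(* The Borel sigma-algebra is generated by open sets, so the closed half-space enters as the
   complement of its open complement. *)
rewrite (_ : row_le i = ~` ~` ((fun x : 'cV[R]_n => \sum_j H i j * x j 0) @^-1`
    [set y | y <= h i 0])); last first.
  by rewrite setCK; apply/seteqP; split=> x /=; rewrite /row_le /= mxE.
by apply: measurableC; apply: sub_sigma_algebra; exact: closed_openC.
Qed.

Lemma measurable_successful (R : realType) (n m : nat) (S : task R n m)
    (kappa : seq 'cV[R]_n -> 'cV[R]_m) Z XN :
  mpc_controller S kappa Z XN ->
  measurable ([set ws | successful S kappa ws] :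
    set ((duration S).-tuple (borelcV R n))).
Proof.
move=> [mcl _].
rewrite [X in measurable X](_ : _ = \bigcap_(t in [set t | (t <= duration S)%N])
    ((fun ws : (duration S).-tuple (borelcV R n) =>
        closed_loop S kappa ws t : borelcV R n) @^-1`
      polyhedron (Hx S) (hx S))).
  apply: bigcap_measurableType => t tT.
  rewrite -[_ @^-1` _]setTI; apply: (mcl t tT) => //.
  exact: measurable_polyhedron.
by apply/seteqP; split.
Qed.

(** * The sample-size bound and the confidence estimate *)

(** Since ln x < 0, clearing the denominator turns the hypothesis into ln (x ^+ k) <= ln b. It is
    applied with x = 1 - [epsilon] and b = [beta]. *)
Lemma exprn_le_of_ln (R : realType) (x b : R) (k : nat) :
  0 < x < 1 -> 0 < b -> ln (1 / b) / ln (1 / x) <= k%:R -> x ^+ k <= b.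
Proof.
move=> /andP[x0 x1] b0; rewrite !div1r !lnV ?posrE//.
rewrite ler_pdivrMr ?oppr_gt0 ?ln_lt0 ?x0//.
by rewrite mulrN lerN2 mulr_natl -lnXn// ler_ln ?posrE ?exprn_gt0//.
Qed.

Theorem proposition1 (R : realType) (n m : nat) (S : task R n m)
  (d : measure_display) (Om : measurableType d) (P : probability Om R)
  (w : nat * nat -> Om -> borelcV R n)
  (XN : set ('cV[R]_n * 'cV[R]_m) -> set 'cV[R]_n)
  (kappa : set ('cV[R]_n * 'cV[R]_m) -> seq 'cV[R]_n -> 'cV[R]_m)
  (Zhat : nat -> set ('cV[R]_n * 'cV[R]_m))
  (jbar : nat) (past : Om) (Zsvm : set ('cV[R]_n * 'cV[R]_m))
  (Nit : nat) (epsilon beta : R) :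
  task_ok S ->
  disturbances S P w ->
  Zhat 1%N = known_estimate S ->
  (forall j, (1 <= j)%N ->
     [/\ constraint_estimate S (Zhat j),
         terminal_set S (Zhat j) (XN (Zhat j)) &
         mpc_controller S (kappa (Zhat j)) (Zhat j) (XN (Zhat j))]) ->
  (1 <= jbar)%N ->
  (forall i t, (1 <= i < jbar)%N -> (t < duration S)%N ->
     distW S (w (i, t) past)) ->
  svm_estimate S (visited S w kappa Zhat past) jbar Zsvm ->
  (forall j, (jbar <= j < jbar + Nit)%N -> Zhat j = Zsvm) ->
  0 < epsilon < 1 ->
  0 < beta < 1 ->
  ln (1 / beta) / ln (1 / (1 - epsilon)) <= Nit%:R ->
  ((1 - beta)%:E <=
   P [set om |
        (forall j, (jbar <= j < jbar + Nit)%N ->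
          successful_iteration S w kappa Zhat j om) ->
        forall j, (jbar <= j)%N -> Zhat j = Zsvm ->
          (P (iteration_failure S w kappa Zhat j) <= epsilon%:E)%E])%E.
Proof.
move=> _ [iidw _] _ ctrl jbar1 _ _ ZhatE /andP[e0 e1] /andP[b0 b1] NitE.
(* Both logarithms are positive, so the bound rules out [Nit] = 0. Hence [jbar] itself is among the
   observed iterations and uses [Zsvm]. *)
have Nit0 : (0 < Nit)%N.
  rewrite lt0n; apply: contraTneq NitE => ->; rewrite -ltNge divr_gt0//.
    by rewrite ln_gt0// div1r invf_gt1.
  by rewrite ln_gt0// div1r invf_gt1 ?subr_gt0// ltrBlDr ltrDl.
have Zjbar : Zhat jbar = Zsvm by apply: ZhatE; rewrite leqnn -addn1 leq_add2l.
pose T := duration S.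
(* Because [Zsvm] does not vary with the outcome, success of every iteration using it is the
   preimage of this one set under that iteration's disturbance tuple; independence of the tuples
   thus passes to the successes. *)
pose good : set (T.-tuple (borelcV R n)) :=
  [set ws | successful S (kappa Zsvm) ws].
have mgood : measurable good.
  by have [_ _] := ctrl _ jbar1; rewrite Zjbar; exact: measurable_successful.
have [mY indY idY] := @iid_tuple _ _ _ _ _ P _ [set j | (1 <= j)%N] T w iidw.
have SIE j : Zhat j = Zsvm ->
    successful_iteration S w kappa Zhat j = dist_seq S w j @^-1` good.
  by rewrite /successful_iteration => ->.
have mSI j : (1 <= j)%N -> measurable (dist_seq S w j @^-1` good : set Om).
  by move=> j1; rewrite -[_ @^-1` _]setTI; exact: mY.
pose q := P (dist_seq S w jbar @^-1` good).
have qE j : (1 <= j)%N -> P (dist_seq S w j @^-1` good) = q.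
  by move=> j1; exact: idY.
have IFE j : (1 <= j)%N -> Zhat j = Zsvm ->
    P (iteration_failure S w kappa Zhat j) = (1 - q)%E.
  by move=> j1 Zj; rewrite /iteration_failure SIE// probability_setC ?qE//; exact: mSI.
have [qle|qgt] := leP (1 - q)%E epsilon%:E.
  rewrite [X in P X](_ : _ = setT); last first.
    apply/seteqP; split=> om //= _ _ j jj Zj.
    by rewrite IFE//; exact: leq_trans jbar1 jj.
  by rewrite probability_setT lee_fin gerBl ltW.
pose s := iota jbar Nit.
have s1 j : j \in s -> (1 <= j)%N.
  by rewrite mem_iota => /andP[jj _]; exact: leq_trans jbar1 jj.
(* Here the failure probability exceeds [epsilon], so the conclusion of the implication is refuted
   at [jbar]: the implication holds exactly when its premise, success of all the iterations in [s],
   fails. *)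
rewrite [X in P X](_ : _ = ~` \bigcap_(j in [set` s]) (dist_seq S w j @^-1` good)); last first.
  apply/seteqP; split=> om /=.
    move=> h allgood.
    suff : (P (iteration_failure S w kappa Zhat jbar) <= epsilon%:E)%E.
      by rewrite IFE// leNgt qgt.
    apply: h => // j jj; rewrite SIE; last exact: ZhatE.
    by apply: allgood; rewrite /= mem_iota.
  move=> h allgood; exfalso; apply: h => j /=; rewrite mem_iota => jj.
  by have := allgood j jj; rewrite SIE//; exact: ZhatE.
rewrite probability_setC; last first.
  by apply: fin_bigcap_measurable => // j /= js; apply: mSI; exact: s1.
rewrite indY ?iota_uniq//.
have -> : (\prod_(j <- s) P (dist_seq S w j @^-1` good) = (fine q ^+ Nit)%:E)%E.
  have qfin : q = (fine q)%:E by rewrite fineK// fin_num_measure//; exact: mSI.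
  rewrite (eq_big_seq (fun=> (fine q)%:E)); last by move=> j js; rewrite -qfin qE// s1.
  by rewrite prodEFin big_const_seq count_predT size_iota iter_mulr_1.
rewrite -EFinB lee_fin lerB//.
have qfin : (fine q)%:E = q by rewrite fineK// fin_num_measure//; exact: mSI.
have qe : fine q <= 1 - epsilon.
  by move: qgt; rewrite -qfin -EFinB lte_fin => /ltW; rewrite lerBrDl lerBrDr addrC.
(* Compare through the power of 1 - [epsilon]: the base [fine q] is nonnegative and at most 1 -
   [epsilon], and the sample-size bound does the rest. *)
apply: (@le_trans _ _ ((1 - epsilon) ^+ Nit)).
  apply: lerXn2r => //; rewrite nnegrE; first exact/fine_ge0/measure_ge0.
  by rewrite subr_ge0 ltW.
by apply: exprn_le_of_ln => //; rewrite subr_gt0 e1 ltrBlDr ltrDl.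
Qed.
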